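(* Let $m,d$ be positive integers and $\mathbb{F}_q$ a finite field with $q$ elements such that $1\le d<q-1$. Let $k:=\binom{m+d}{d}$ and $n:=p_m=q^m+q^{m-1}+\dots+q+1$. Then $$d_{k-s}(\mathrm{PRM}_q(d,m))=n-s\quad\text{for } s=0,1,\dots,d.$$
   Context: Choose for each point of $\mathbb{P}^m(\mathbb{F}_q)$ its unique representative in $\mathbb{F}_q^{m+1}$ whose first nonzero coordinate is $1$, and let $\mathsf{P}_1,\dots,\mathsf{P}_n$ be an ordered listing of these representatives, $n=p_m$. The projective Reed-Muller code of order $d$ and length $p_m$ is $$\mathrm{PRM}_q(d,m):=\{(F(\mathsf{P}_1),\dots,F(\mathsf{P}_n)) : F\in S_d\}\subseteq\mathbb{F}_q^n,$$ where $S_d$ is the space of homogeneous polynomials of degree $d$ in $\mathbb{F}_q[x_0,\dots,x_m]$ (including zero). For a linear code $C\subseteq\mathbb{F}_q^n$ and $1\le r\le\dim C$, the $r$th higher weight (generalized Hamming weight) $d_r(C)$ is the minimum of $|\mathrm{Supp}(D)|$ over all $r$-dimensional subspaces $D$ of $C$, where $\mathrm{Supp}(D)$ is the set of coordinate positions $i$ such that some $c\in D$ has $c_i\ne 0$. *)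

(* Defs.v *)
From HB Require Import structures.
From mathcomp Require Import all_boot all_order all_algebra.
From mathcomp Require Import mpoly.

Set Implicit Arguments.
Unset Strict Implicit.
Unset Printing Implicit Defensive.

Import GRing.Theory.
Local Open Scope ring_scope.

Section HigherWeights.
Variables (F : finFieldType) (n : nat).

Definition Supp (D : {vspace 'rV[F]_n}) : {set 'I_n} :=
  [set i | [exists c : 'rV[F]_n, (c \in D) && (c 0 i != 0)]].

(* d_r(C) = w, including the requirement that d_r(C) be defined. *)
Definition is_higher_weight (C : {vspace 'rV[F]_n}) (r w : nat) : Prop :=
  [/\ (1 <= r <= \dim C)%N,
      exists D : {vspace 'rV[F]_n},
        [/\ (D <= C)%VS, \dim D = r & #|Supp D| = w]
    & forall D : {vspace 'rV[F]_n},
        (D <= C)%VS -> \dim D = r -> (w <= #|Supp D|)%N].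

End HigherWeights.

Definition proj_size (q m : nat) : nat := (\sum_(i < m.+1) q ^ i)%N.

Section ProjectiveReedMuller.
Variables (F : finFieldType) (m : nat).

Definition normalized (v : 'rV[F]_m.+1) : bool :=
  [exists i : 'I_m.+1,
    (v 0 i == 1) && [forall j : 'I_m.+1, (j < i)%N ==> (v 0 j == 0)]].

Definition point_listing (n : nat) (P : n.-tuple 'rV[F]_m.+1) : Prop :=
  uniq P /\ (forall v : 'rV[F]_m.+1, (v \in P) = normalized v).

Section Code.
Variables (d n : nat) (P : n.-tuple 'rV[F]_m.+1).

(* dhomog is the space of homogeneous polynomials of degree d, with 0. *)
Definition PRM_eval (f : dhomog m.+1 F d) : 'rV[F]_n :=
  \row_(i < n) (f : {mpoly F[m.+1]}).@[tnth P i 0].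

Fact PRM_eval_is_linear : linear PRM_eval.
Proof.
by move=> a f g; apply/rowP=> i; rewrite !mxE /= mevalD mevalZ.
Qed.

HB.instance Definition _ :=
  GRing.isLinear.Build F (dhomog m.+1 F d) 'rV[F]_n _ PRM_eval
    PRM_eval_is_linear.

Definition PRM : {vspace 'rV[F]_n} := limg (linfun PRM_eval).

Lemma memPRM (c : 'rV[F]_n) :
  c \in PRM <-> exists2 f : {mpoly F[m.+1]},
    f \is d.-homog & c = \row_(i < n) f.@[tnth P i 0].
Proof.
split=> [/memv_imgP[f _ ->]|[f fd ->]].
  by exists f; [exact: dhomog_is_dhomog | rewrite lfunE].
apply/memv_imgP; exists (DHomog fd); first exact: memvf.
by rewrite lfunE.
Qed.

End Code.

Lemma card_normalized : #|normalized| = proj_size #|F| m.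
Proof.
pose Q (i j : 'I_m.+1) : pred F :=
  if (j < i)%N then pred1 0 else if j == i then pred1 1 else predT.
pose A i := [set v : 'rV[F]_m.+1 | [ffun j => v 0 j] \in family (Q i)].
have AP (i : 'I_m.+1) (v : 'rV[F]_m.+1) : reflect (v 0 i = 1 /\ forall j : 'I_m.+1, (j < i)%N -> v 0 j = 0)
                      (v \in A i).
  rewrite inE; apply: (iffP familyP) => [h|[h1 h0] j].
    split=> [|j lt_ji]; first by have := h i; rewrite ffunE /Q ltnn eqxx => /eqP.
    by have := h j; rewrite ffunE /Q lt_ji => /eqP.
  rewrite ffunE /Q; case: ifP => [/h0 ->|_]; first by rewrite inE.
  by case: eqP => [->|_]; rewrite ?inE ?h1.
have cardA (i : 'I_m.+1) : #|A i| = (#|F| ^ (m - i))%N.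
  pose g (f : {ffun 'I_m.+1 -> F}) : 'rV[F]_m.+1 := \row_j f j.
  have gK : cancel g (fun v : 'rV[F]_m.+1 => [ffun j => v 0 j]).
    by move=> f; apply/ffunP=> j; rewrite ffunE mxE.
  have -> : A i = g @: [set f in family (Q i)].
    apply/setP=> v; apply/idP/imsetP => [|[f]]; last first.
      by rewrite inE => fQ ->; rewrite inE gK.
    rewrite inE => vQ; exists [ffun j => v 0 j]; first by rewrite inE.
    by apply/rowP=> j; rewrite mxE ffunE.
  rewrite card_imset; last exact: can_inj gK.
  rewrite cardsE card_family foldrE big_map big_enum /=.
  rewrite (bigID (fun j : 'I_m.+1 => (i < j)%N)) /= [X in (_ * X)%N]big1.
    rewrite muln1 (eq_bigr (fun=> #|F|)) => [|j lt_ij].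
      rewrite prod_nat_const; congr (_ ^ _)%N.
      rewrite -sum1_card -(big_mkord (fun j => (i < j)%N) (fun=> 1%N)).
      rewrite (@big_cat_nat _ _ _ i.+1) //= big_nat_cond big1 ?add0n.
        rewrite big_nat_cond (eq_bigl (fun j => (i.+1 <= j < m.+1)%N)).
          by rewrite -big_nat sum_nat_const_nat muln1 subSS.
        by move=> j; rewrite -andbA andbA; case: (i < j)%N; rewrite ?andbT ?andbF.
      by move=> j /andP[/andP[_ +] lt_ij]; rewrite ltnS leqNgt lt_ij.
    by rewrite /Q ltnNge (ltnW lt_ij) /= -val_eqE /= gtn_eqF.
  move=> j; rewrite -leqNgt leq_eqVlt /Q => /orP[/eqP/val_inj ->|->].
    by rewrite ltnn eqxx card1.
  by rewrite card1.
have tA : forall i j v, v \in A i -> v \in A j -> i = j.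
  move=> i j v /AP[vi v0] /AP[vj v0']; apply/val_inj; apply/eqP.
  by case: ltngtP => // [/v0' /eqP|/v0 /eqP]; rewrite ?vi ?vj oner_eq0.
have -> : #|normalized| = #|\bigcup_i A i|.
  apply: eq_card => v; apply/existsP/bigcupP => [[i /andP[/eqP h1 /forallP h0]]|].
    by exists i => //; apply/AP; split=> // j lt_ji; apply/eqP; exact: implyP (h0 j) _.
  case=> i _ /AP[h1 h0]; exists i; rewrite h1 eqxx /=.
  by apply/forallP=> j; apply/implyP=> /h0 ->.
rewrite -sum1_card partition_disjoint_bigcup; last first.
  move=> i j ne_ij; rewrite -setI_eq0; apply/eqP/setP=> v; rewrite !inE.
  apply/negP=> /andP[]; have := tA i j v; rewrite !inE => h vi vj.
  by move: ne_ij; rewrite (h vi vj) eqxx.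
rewrite (reindex_inj rev_ord_inj) /=; apply: eq_bigr => i _.
by rewrite sum1_card cardA /= subSS subKn // -ltnS.
Qed.

Lemma point_listing_exists :
  exists P : (proj_size #|F| m).-tuple 'rV[F]_m.+1, point_listing P.
Proof.
have sz : size (enum normalized) == proj_size #|F| m.
  by rewrite -cardE card_normalized.
exists (Tuple sz); split=> [|v]; first exact: enum_uniq.
by rewrite /= mem_enum.
Qed.

End ProjectiveReedMuller.

(* Main.v *)
(* Any d + 1 points of the projective space impose independent conditions on
   the forms of degree d: a product of linear forms vanishes at d of them but
   not at the remaining one. Hence for t <= d + 1 the subcode of words vanishing
   at t given positions has codimension exactly t. With t = s this gives a
   subcode of codimension s supported off s positions; with t = s + 1 it shows
   that a subcode of codimension s vanishes identically at no more than s
   positions. *)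

From HB Require Import structures.
Require Import Defs.
From mathcomp Require Import all_boot all_order all_algebra.
From mathcomp Require Import mpoly.

Set Implicit Arguments.
Unset Strict Implicit.
Unset Printing Implicit Defensive.

Import GRing.Theory.
Local Open Scope ring_scope.

Lemma exists_subset_card (T : finType) (A : {set T}) (t : nat) :
  (t <= #|A|)%N -> exists2 B : {set T}, B \subset A & #|B| = t.
Proof.
case/card_geqP=> s [us ss sA]; exists [set x in s].
  by apply/subsetP=> x; rewrite inE; apply: sA.
by rewrite cardsE (card_uniqP us).
Qed.

(** * Shortened codes and higher weights *)

Section Shortening.
Variables (F : finFieldType) (n : nat).
Implicit Types (A : {set 'I_n}) (C D : {vspace 'rV[F]_n}) (c : 'rV[F]_n).

Definition restr A c : 'rV[F]_#|A| := \row_i c 0 (enum_val i).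

Fact restr_is_linear A : linear (restr A).
Proof. by move=> a c e; apply/rowP=> i; rewrite !mxE. Qed.

HB.instance Definition _ A :=
  GRing.isLinear.Build F 'rV[F]_n 'rV[F]_#|A| _ (restr A) (restr_is_linear A).

(** The shortening of [C] at [A], with the zero coordinates kept so that it remains a subspace of
    [C]. *)
Definition shorten C A : {vspace 'rV[F]_n} := (C :&: lker (linfun (restr A)))%VS.

Lemma mem_shorten C A c :
  reflect (c \in C /\ {in A, forall i, c 0 i = 0}) (c \in shorten C A).
Proof.
rewrite memv_cap memv_ker lfunE /=; apply: (iffP andP) => -[cC h]; split=> //.
  move=> i iA; move/eqP/rowP/(_ (enum_rank_in iA i)): h.
  by rewrite !mxE enum_rankK_in.
by apply/eqP/rowP=> i; rewrite !mxE h ?enum_valP.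
Qed.

Lemma sub_shorten C A D :
  (D <= shorten C A)%VS = (D <= C)%VS && (A \subset ~: Supp D).
Proof.
apply/subvP/andP => [h|[/subvP DC /subsetP AD] c cD].
  split; first by apply/subvP=> c /h /mem_shorten[].
  apply/subsetP=> i iA; rewrite !inE; apply/existsP=> -[c /andP[]].
  by move=> /h /mem_shorten[_ ->] //; rewrite eqxx.
apply/mem_shorten; split=> [|i /AD]; first exact: DC.
rewrite !inE => /existsPn/(_ c); rewrite cD /= negbK; exact: eqP.
Qed.

(* Equivalently, vanishing at any t + 1 coordinates imposes t + 1 independent
   linear conditions on C. *)
Definition separates C t := forall A (i : 'I_n), (#|A| <= t)%N -> i \notin A ->
  exists c, [/\ c \in C, c 0 i != 0 & {in A, forall j, c 0 j = 0}].

(** Rank-nullity for [restr A], which is onto: for [i] in [A] the rest of [A] has at most [t]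
    elements, so some word of [C] vanishes there but not at [i], and it restricts to a nonzero
    multiple of a unit vector. *)
Lemma dim_shorten C t A :
  separates C t -> (#|A| <= t.+1)%N -> (\dim (shorten C A) + #|A| = \dim C)%N.
Proof.
move=> sepC leA; rewrite -(limg_ker_dim (linfun (restr A)) C); congr (_ + _)%N.
suff -> : (linfun (restr A) @: C)%VS = fullv by rewrite dimvf /dim /= mul1n.
apply: subv_anti; rewrite subvf /=; apply/subvP=> v _.
rewrite [v]row_sum_delta; apply: memv_suml => i _; apply: memvZ.
have iA := enum_valP i.
have [||c [cC ci c0]] := sepC (A :\ enum_val i) (enum_val i).
- by move: leA; rewrite (cardsD1 (enum_val i)) iA.
- by rewrite !inE eqxx.
apply/memv_imgP; exists ((c 0 (enum_val i))^-1 *: c); first exact: memvZ.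
rewrite lfunE; apply/rowP=> j; rewrite !mxE eqxx /=.
have [->|ji] := eqVneq j i; first by rewrite mulVf.
rewrite [c 0 (enum_val j)]c0 ?mulr0 //; apply/setD1P; split; last exact: enum_valP.
by apply: contra ji => /eqP/enum_val_inj->.
Qed.

Lemma separates_higher_weight C s :
  (s < \dim C)%N -> separates C s -> is_higher_weight C (\dim C - s) (n - s).
Proof.
move=> ltsC sepC.
have low D : (D <= C)%VS -> \dim D = (\dim C - s)%N -> (n - s <= #|Supp D|)%N.
  move=> DC dimD; rewrite leq_subLR -[X in (X <= _)%N](card_ord n) -(cardsC (Supp D)).
  rewrite addnC leq_add2r leqNgt; apply/negP => /exists_subset_card[A AD cA].
  have dimA : (\dim (shorten C A) + s.+1 = \dim C)%N.
    by rewrite -cA (@dim_shorten C s) ?cA.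
  have /dimvS : (D <= shorten C A)%VS by rewrite sub_shorten DC AD.
  by rewrite dimD -dimA addnS -addSn addnK ltnn.
have [|A _ cA] := @exists_subset_card _ [set: 'I_n] s.
  rewrite cardsT card_ord; apply: ltnW (leq_trans ltsC _).
  by apply: leq_trans (dimvS (subvf C)) _; rewrite dimvf /dim /= mul1n.
have dimA : \dim (shorten C A) = (\dim C - s)%N.
  by rewrite -(@dim_shorten C s A) ?cA // addnK.
split=> //; first by rewrite subn_gt0 ltsC leq_subr.
exists (shorten C A); have : (shorten C A <= shorten C A)%VS by [].
rewrite sub_shorten => /andP[sC dA]; split=> //.
(* Vanishing on [A] only bounds the support above by [n - s]; equality comes from [low]. *)
apply/eqP; rewrite eqn_leq low // andbT.
rewrite -[n in leqRHS]card_ord -cA -[A]setCK -cardsCs.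
by apply: subset_leq_card; rewrite -setCS setCK.
Qed.

End Shortening.

(** * Reduced polynomials over a finite field *)

Lemma Vandermonde_unit (F : fieldType) (n : nat) (a : 'rV[F]_n) :
  injective (a 0) -> Vandermonde n a \in unitmx.
Proof.
move=> inj_a; rewrite unitmxE det_Vandermonde unitfE.
apply/prodf_neq0 => i _; apply/prodf_neq0 => j ltij.
by rewrite subr_eq0; apply: contraTneq ltij => /inj_a ->; rewrite ltnn.
Qed.

(* A product of columns of the inverse Vandermonde matrix of the elements of F
   gives a functional on functions F^n -> F extracting the coefficient of a
   prescribed monomial with exponents less than #|F|. *)
Lemma mpoly_reduced_eq0 (F : finFieldType) (n : nat) (p : {mpoly F[n]}) :
  {in msupp p, forall e : 'X_{1..n}, forall i, (e i < #|F|)%N} ->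
  (forall v : 'I_n -> F, p.@[v] = 0) -> p = 0.
Proof.
move=> redp p0; apply/eqP; rewrite -msupp_eq0; apply/eqP.
case defp: (msupp p) => [//|e s].
have ep : e \in msupp p by rewrite defp mem_head.
pose V := Vandermonde #|F| (\row_(j < #|F|) (enum_val j : F)).
have VI : V *m invmx V = 1%:M.
  by rewrite mulmxV // Vandermonde_unit // => i j; rewrite !mxE => /enum_val_inj.
pose o i := Ordinal (redp e ep i).
pose dual (g : {ffun 'I_n -> 'I_#|F|}) := \prod_i invmx V (g i) (o i).
have dualE e' : e' \in msupp p -> \sum_g dual g * (p@_e' *
    \prod_i (enum_val \o g) i ^+ e' i) = p@_e' * (e' == e)%:R.
  move=> e'p; under eq_bigr do rewrite mulrCA -big_split.
  rewrite -mulr_sumr; congr (_ * _).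
  (* The sum over all points factors into one-variable sums, each an entry of [V *m invmx V]. *)
  rewrite -(bigA_distr_bigA (fun i j => invmx V j (o i) * enum_val j ^+ e' i)) /=.
  transitivity (\prod_i ((e' i == e i)%:R : F)).
    apply: eq_bigr => i _; pose o' := Ordinal (redp e' e'p i).
    have /matrixP/(_ o' (o i)) := VI; rewrite !mxE -val_eqE /= => <-.
    by apply: eq_bigr => j _; rewrite !mxE mulrC.
  have [->|ne] := eqVneq; first by rewrite big1 // => i; rewrite eqxx.
  have [i nei|eqe] := pickP (fun i => e' i != e i).
    by rewrite (bigD1 i) //= (negPf nei) mul0r.
  by case/eqP: ne; apply/mnmP=> i; apply/eqP/negbFE/eqe.
have: \sum_g dual g * p.@[enum_val \o g] = 0.
  by apply: big1 => g _; rewrite p0 mulr0.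
under eq_bigr do rewrite mevalE mulr_sumr.
rewrite exchange_big big_seq (eq_bigr _ dualE) -big_seq.
rewrite (bigD1_seq e) ?msupp_uniq //= eqxx mulr1 big1 => [|e' /negPf->]; last first.
  by rewrite mulr0.
by rewrite addr0 => /eqP; rewrite mcoeff_eq0 ep.
Qed.

(** * Normalized representatives and linear forms *)

Section Points.
Variables (F : finFieldType) (m : nat).
Implicit Types v w : 'rV[F]_m.+1.

Lemma normalized_scale v : v != 0 -> exists2 c, c != 0 & normalized (c *: v).
Proof.
case/rV0Pn=> i0 vi0.
case: (@arg_minnP _ i0 (fun i => v 0 i != 0) val vi0) => i vi mini.
exists (v 0 i)^-1; first by rewrite invr_eq0.
apply/existsP; exists i; rewrite mxE mulVf // eqxx.
apply/forallP=> j; apply/implyP=> ltji; rewrite mxE mulf_eq0 orbC.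
by apply/orP; left; apply: contraTT ltji => /mini; rewrite -leqNgt.
Qed.

Lemma normalized_coord_neq0 v : normalized v -> exists i, v 0 i != 0.
Proof. by case/existsP=> i /andP[/eqP vi _]; exists i; rewrite vi oner_eq0. Qed.

(** Vanishing minors make the vectors proportional. The leading positions agree, since otherwise the
    minor on these two columns would give [1 = 0]; the common leading entry 1 then fixes the
    scalar. *)
Lemma normalized_minors v w : normalized v -> normalized w ->
  (forall a b, v 0 a * w 0 b = v 0 b * w 0 a) -> v = w.
Proof.
case/existsP=> i /andP[/eqP vi /forallP v0] /existsP[j /andP[/eqP wj /forallP w0]] h.
have ij : i = j.
  apply: val_inj; case: (ltngtP i j) => // lt.
    have /eqP := implyP (w0 i) lt; have := h i j; rewrite vi wj mul1r => + wi.
    by rewrite wi mulr0 => /eqP; rewrite oner_eq0.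
  have /eqP := implyP (v0 j) lt; have := h i j; rewrite vi wj mul1r => + wi.
  by rewrite wi mul0r => /eqP; rewrite oner_eq0.
by apply/rowP=> c; have := h i c; rewrite vi ij wj mul1r mulr1.
Qed.

Lemma dhomogXU i : ('X_i : {mpoly F[m.+1]}) \is 1.-homog.
Proof. by rewrite dhomogX /= mdeg1. Qed.

Lemma separating_linear_form v w : normalized v -> normalized w -> v != w ->
  exists f : {mpoly F[m.+1]}, [/\ f \is 1.-homog, f.@[v 0] != 0 & f.@[w 0] = 0].
Proof.
move=> nv nw vw.
have [[a b] /= ne|no] := pickP (fun ab => v 0 ab.1 * w 0 ab.2 != v 0 ab.2 * w 0 ab.1).
  (* A minor that is nonzero at [v], read as a linear form in its first vector, vanishes at [w]. *)
  exists (w 0 b *: 'X_a - w 0 a *: 'X_b); split.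
  - by rewrite rpredB // rpredZ // dhomogXU.
  - by rewrite mevalB !mevalZ !mevalXU subr_eq0 mulrC [eqbRHS]mulrC.
  - by rewrite mevalB !mevalZ !mevalXU mulrC subrr.
by case/eqP: vw; apply: normalized_minors => // a b; apply/eqP; apply: negbFE (no (a, b)).
Qed.

Lemma meval_dhomog_scale d (f : {mpoly F[m.+1]}) c v :
  f \is d.-homog -> f.@[(c *: v) 0] = c ^+ d * f.@[v 0].
Proof.
move=> fd; rewrite !mevalE mulr_sumr !big_seq; apply: eq_bigr => e ef.
rewrite mulrCA; congr (_ * _).
rewrite -(dhomog_mf fd ef) /= mdegE expr_sum -big_split /=.
by apply: eq_bigr => i _; rewrite mxE exprMn.
Qed.

End Points.

(** * Dimension and separation for projective Reed-Muller codes *)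

Section Code.
Variables (F : finFieldType) (m d n : nat).
Variables (P : n.-tuple 'rV[F]_m.+1) (hP : point_listing P).

Lemma normalized_tnth i : normalized (tnth P i).
Proof. by rewrite -(proj2 hP) mem_tnth. Qed.

(** Evaluation is injective on forms: by homogeneity a form vanishing at all representatives
    vanishes everywhere, at the origin because [d > 0], and its exponents are at most [d < #|F|], so
    it is zero. *)
Lemma dim_PRM : (0 < d < #|F|)%N -> \dim (PRM d P) = 'C(m + d, d).
Proof.
case/andP=> d0 ltdF.
rewrite limg_dim_eq ?dimvf ?[RHS](f_equal2 _ (addnC m d) erefl) //.
apply/eqP; rewrite -subv0; apply/subvP=> f; rewrite memv_cap memvf /= memv_ker lfunE /=.
move=> /eqP/rowP f0; rewrite memv0; apply/eqP/val_inj => /=.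
have fd : (f : {mpoly F[m.+1]}) \is d.-homog by exact: dhomog_is_dhomog.
apply: mpoly_reduced_eq0 => [e ef i|v].
  apply: leq_ltn_trans ltdF; rewrite -(dhomog_mf fd ef) /= mdegE.
  by rewrite (bigD1 i) //= leq_addr.
have <- : (f : {mpoly F[m.+1]}).@[(\row_i v i) 0] = f.@[v].
  by apply: meval_eq => i; rewrite mxE.
move: (\row_i v i) => {}v.
have [->|/normalized_scale[c c0 nv]] := eqVneq v 0.
  by rewrite -(scale0r 0) (@meval_dhomog_scale _ _ d) // expr0n gtn_eqF // mul0r.
move: nv; rewrite -(proj2 hP) => /tnthP[i Pi].
apply: (mulfI (expf_neq0 d c0)); rewrite mulr0 -meval_dhomog_scale //.
by have := f0 i; rewrite !mxE -Pi.
Qed.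

Lemma PRM_separates : separates (PRM d P) d.
Proof.
move=> A i leA iA.
have /fin_all_exists[l lP] j : exists f : {mpoly F[m.+1]}, j \in A ->
    [/\ f \is 1.-homog, f.@[tnth P i 0] != 0 & f.@[tnth P j 0] = 0].
  have [jA|] := boolP (j \in A); last by exists 0.
  have [|f hf] := separating_linear_form (normalized_tnth i) (normalized_tnth j).
    apply: contraNneq iA => /eqP; rewrite !(tnth_nth 0) nth_uniq ?size_tuple ?(proj1 hP) //.
    by move/eqP/val_inj->.
  by exists f.
have [a Pia] := normalized_coord_neq0 (normalized_tnth i).
(* The power of ['X_a], a coordinate nonzero at point [i], raises the degree from [#|A|] to exactly
   [d]. *)
pose f := \prod_(j in A) l j * 'X_a ^+ (d - #|A|).
exists (\row_j f.@[tnth P j 0]); split.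
- apply/memPRM; exists f => //.
  rewrite -[X in X.-homog](subnKC leA); apply: dhomogM; last first.
    by rewrite -[X in X.-homog]mul1n dhomogMn // dhomogXU.
  rewrite -sum1_card; apply: (big_ind2 (fun p e => p \is e.-homog)).
  + exact: dhomog1.
  + by move=> p e p' e' ? ?; apply: dhomogM.
  + by move=> j /lP[].
- rewrite mxE mevalM rmorph_prod rmorphXn /= mevalXU mulf_neq0 ?expf_neq0 //.
  by apply/prodf_neq0 => j /lP[].
- move=> j jA; rewrite mxE mevalM rmorph_prod (bigD1 j) //=.
  by case: (lP j jA) => _ _ ->; rewrite !mul0r.
Qed.

End Code.

Theorem corollary4p6 (F : finFieldType) (q m d : nat)
    (hq : #|F| = q) (hm : (0 < m)%N) (hd : (1 <= d < q - 1)%N)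
    (P : (proj_size q m).-tuple 'rV[F]_m.+1) (hP : point_listing P)
    (s : nat) (hs : (s <= d)%N) :
  is_higher_weight (PRM d P) ('C(m + d, d) - s)%N (proj_size q m - s)%N.
Proof.
have [d0 ltdq] := andP hd.
have dimC : \dim (PRM d P) = 'C(m + d, d).
  by apply: dim_PRM; rewrite // d0 hq (leq_trans ltdq) ?leq_subr.
rewrite -dimC; apply: separates_higher_weight.
  (* Since [m >= 1], [d < d + 1 = 'C(1 + d, d) <= 'C(m + d, d)]. *)
  rewrite dimC (leq_ltn_trans hs) //.
  by apply: leq_trans (leq_bin2l d (leq_add hm (leqnn d))); rewrite add1n binSn.
move=> A i leA; apply: PRM_separates => //; exact: leq_trans hs.
Qed.
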